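(* Let ${\bf w}^*=({\bf x}^*;{\bf z}^* )$ be a P-stationary point of (P) with some $\tau\in(0,\tau_* )$, $\tau_*:=\min\{\tau_1,\tau_2\}$. Assume: $\nabla^2 f({\bf x}^* )$ is nonsingular; $A_{\Gamma_*}$ has full row rank; $H(\Gamma)$ is nonsingular for every $\Gamma\subseteq\Gamma_*$ (equivalently $c_*>0$); and $\nabla^2 f$ is Lipschitz continuous with constant $L_*>0$ on a neighbourhood of ${\bf x}^*$. Let $\rho>0$, $\alpha\in(0,1)$, $0<\mu_{-1}\le c_*/2$, and set $\theta_*:=L_*+2\rho C_*$. Then there exists $\delta>0$ such that, for every initial point ${\bf w}^0\in N({\bf w}^*,\delta)$, the Newton iteration below is well defined for all $k\ge0$ (i.e. $\nabla F_{\mu_k}({\bf w}^k;T_k)$ is nonsingular for every $k$) and: (a) ${\bf d}^k\to0$ and ${\bf w}^k\to{\bf w}^*$; (b) $\|{\bf w}^{k+1}-{\bf w}^*\|\le(\theta_*/c_* )\|{\bf w}^k-{\bf w}^*\|^2$ for all $k\ge0$; (c) $\|F({\bf w}^{k+1};T_{k+1})\|\le\theta_*C_*c_*^{-3}\|F({\bf w}^k;T_k)\|^2$ for all $k\ge0$; moreover, for every $k\ge1$, $\|F({\bf w}^k;T_k)\|\le\theta_*C_*^3c_*^{-3}\,2^{2-2k}\|{\bf w}^0-{\bf w}^*\|^2$, so that for any $\epsilon>0$ and ${\bf w}^0\ne{\bf w}^*$ one has $\|F({\bf w}^k;T_k)\|\le\epsilon$ whenever $k\ge1$ and $k\ge\big\lceil\log_2\big(2\sqrt{\theta_*(C_*/c_*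 )^3}\,\|{\bf w}^0-{\bf w}^*\|\big)-\log_2\sqrt{\epsilon}\,\big\rceil$. The iteration: given ${\bf w}^k=({\bf x}^k;{\bf z}^k)$, set $T_k:={\mathcal S}({\bf w}^k)\cup{\mathcal E}^o({\bf w}^k)$, $\mu_k:=\min\{\alpha\mu_{k-1},\rho\|F({\bf w}^k;T_k)\|\}$, let ${\bf d}^k$ solve $\nabla F_{\mu_k}({\bf w}^k;T_k)\,{\bf d}=-F({\bf w}^k;T_k)$, and set ${\bf w}^{k+1}:={\bf w}^k+{\bf d}^k$.
   Context: Standing setting: problem (P) is $\min_{{\bf x}\in\mathbb{R}^n} f({\bf x})+\lambda\|(A{\bf x}+{\bf b})_+\|_0$ with $f$ twice continuously differentiable, $\lambda>0$, $A\in\mathbb{R}^{m\times n}$ with rows $A_i$, ${\bf b}\in\mathbb{R}^m$; ${\bf z}_+$ componentwise positive part, $\|\cdot\|_0$ counts nonzeros; $A_\Gamma$, ${\bf z}_\Gamma$ row-submatrix/subvector indexed by $\Gamma$, $\overline\Gamma$ complement in $\{1,\dots,m\}$; $\|\cdot\|$ Euclidean/spectral norm, $\sigma_{\min}$ smallest singular value; $N({\bf w}^*,\delta)$ open ball in $\mathbb{R}^{n+m}$. $\mathrm{Prox}_{\alpha\|(\cdot)_+\|_0}({\bf z}):=\arg\min_{{\bf y}}\frac12\|{\bf y}-{\bf z}\|^2+\alpha\|{\bf y}_+\|_0$. $({\bf x}^*,{\bf z}^* )$ is P-stationary with $\tau$ if $\nabla f({\bf x}^* )+A^\top{\bf z}^*=0$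 and $A{\bf x}^*+{\bf b}\in\mathrm{Prox}_{\tau\lambda\|(\cdot)_+\|_0}(A{\bf x}^*+{\bf b}+\tau{\bf z}^* )$. $\Gamma_*:=\{i:A_i{\bf x}^*+b_i=0\}$, ${\bf y}^*:=A{\bf x}^*+{\bf b}$, ${\bf p}^*:=-(A_{\Gamma_*}A_{\Gamma_*}^\top)^{-1}A_{\Gamma_*}\nabla f({\bf x}^* )$; $\tau_1:=+\infty$ if ${\bf y}^*\le0$, else $\min\{(y_i^* )^2/(2\lambda):y_i^*>0\}$; $\tau_2:=+\infty$ if $\Gamma_*=\emptyset$ or ${\bf p}^*=0$, else $2\lambda/\max_i|p_i^*|^2$. Index sets for ${\bf w}=({\bf x};{\bf z})$, $c:=\sqrt{\tau\lambda/2}$: ${\mathcal S}({\bf w})=\{i:|A_i{\bf x}+b_i+\tau z_i-c|<c\}$, ${\mathcal E}^o({\bf w})=\{i:A_i{\bf x}+b_i=0,\ |\tau z_i-c|=c\}$. $F({\bf w};\Gamma):=\big(\nabla f({\bf x})+A_\Gamma^\top{\bf z}_\Gamma;\ A_\Gamma{\bf x}+{\bf b}_\Gamma;\ {\bf z}_{\overline\Gamma}\big)\in\mathbb{R}^{n+m}$; for $\mu\ge0$, $\nabla F_\mu({\bf w};\Gamma)$ is the matrix which, in block form with respect to the variable partition $({\bf x},{\bf z}_\Gamma,{\bf z}_{\overline\Gamma})$, equals $\begin{bmatrix}\nabla^2 f({\bf x}) & A_\Gamma^\top & 0\\ A_\Gamma & -\mu I & 0\\ 0 & 0 & I\end{bmatrix}$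 (so $\nabla F_0$ is the Jacobian of $F(\cdot;\Gamma)$). $H(\Gamma):=\begin{bmatrix}\nabla^2 f({\bf x}^* ) & A_\Gamma^\top\\ A_\Gamma & 0\end{bmatrix}$; $C_*:=2\max\{1,\|H(\Gamma_* )\|\}$, $c_*:=\frac12\min\{1,\min_{\Gamma\subseteq\Gamma_*}\sigma_{\min}(H(\Gamma))\}$. *)

(* Defs.v *)
From HB Require Import structures.
From mathcomp Require Import all_boot all_order all_algebra.
From mathcomp Require Import all_classical all_reals all_analysis.
Set Implicit Arguments. Unset Strict Implicit. Unset Printing Implicit Defensive.
Import Order.TTheory GRing.Theory Num.Theory.
Import numFieldNormedType.Exports.
Local Open Scope classical_set_scope.
Local Open Scope ring_scope.

Section Defs.
Variable R : realType.

Definition enorm {k : nat} (v : 'cV[R]_k) : R := Num.sqrt (\sum_i (v i 0) ^+ 2).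

Definition specnorm {p q : nat} (M : 'M[R]_(p, q)) : R :=
  sup [set enorm (M *m v) | v in [set v : 'cV[R]_q | enorm v <= 1]].

Definition smin {k : nat} (M : 'M[R]_k) : R :=
  inf [set enorm (M *m v) | v in [set v : 'cV[R]_k | enorm v = 1]].

Definition l0pos {k : nat} (y : 'cV[R]_k) : R := (#|[set i | 0 < y i 0]|)%:R.

Definition in_prox {k : nat} (a : R) (z y : 'cV[R]_k) : Prop :=
  forall y' : 'cV[R]_k,
    enorm (y - z) ^+ 2 / 2 + a * l0pos y <= enorm (y' - z) ^+ 2 / 2 + a * l0pos y'.

Variables (n m : nat) (A : 'M[R]_(m, n)) (b : 'cV[R]_m).

Definition xpart (w : 'cV[R]_(n + m)) : 'cV[R]_n := usubmx w.
Definition zpart (w : 'cV[R]_(n + m)) : 'cV[R]_m := dsubmx w.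

Definition Asub (G : {set 'I_m}) : 'M[R]_(#|G|, n) :=
  \matrix_(i < #|G|, j < n) A (enum_val i) j.

Definition Pstationary (grad : 'cV[R]_n -> 'cV[R]_n) (lambda tau : R)
  (xs : 'cV[R]_n) (zs : 'cV[R]_m) : Prop :=
  grad xs + A^T *m zs = 0 /\
  in_prox (tau * lambda) (A *m xs + b + tau *: zs) (A *m xs + b).

Definition Gstar (xs : 'cV[R]_n) : {set 'I_m} :=
  [set i | (A *m xs + b) i 0 == 0].

Definition pstar (grad : 'cV[R]_n -> 'cV[R]_n) (xs : 'cV[R]_n) : 'cV[R]_#|Gstar xs| :=
  - (invmx (Asub (Gstar xs) *m (Asub (Gstar xs))^T) *m Asub (Gstar xs) *m grad xs).

Definition tau1 (lambda : R) (xs : 'cV[R]_n) : \bar R :=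
  ereal_inf [set ((((A *m xs + b) i 0) ^+ 2 / (2 * lambda))%:E)%E
            | i in [set i | 0 < (A *m xs + b) i 0]].

Definition tau2 (grad : 'cV[R]_n -> 'cV[R]_n) (lambda : R) (xs : 'cV[R]_n) : \bar R :=
  if (Gstar xs == finset.set0) || (pstar grad xs == 0) then +oo%E
  else ((2 * lambda / \big[Num.max/0]_i ((pstar grad xs i 0) ^+ 2))%:E)%E.

Definition taustar grad lambda xs : \bar R :=
  Order.min (tau1 lambda xs) (tau2 grad lambda xs).

Definition Hmat (hess : 'cV[R]_n -> 'M[R]_n) (xs : 'cV[R]_n) (G : {set 'I_m})
  : 'M[R]_(n + #|G|) :=
  block_mx (hess xs) (Asub G)^T (Asub G) 0.

Definition Cstar hess xs : R := 2 * Num.max 1 (specnorm (Hmat hess xs (Gstar xs))).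

(* c_* = 1/2 min{1, min_{G subset Gamma_*} sigma_min(H(G))}; a 0x0 matrix has
   sigma_min = +oo by convention, i.e. it does not contribute to the min. *)
Definition cstar hess xs : R :=
  (\big[Num.min/1]_(G : {set 'I_m} | G \subset Gstar xs)
     (if (n + #|G|)%N == 0%N then 1 else smin (Hmat hess xs G))) / 2.

Definition Sset (lambda tau : R) (w : 'cV[R]_(n + m)) : {set 'I_m} :=
  let c := Num.sqrt (tau * lambda / 2) in
  [set i | `|(A *m xpart w + b) i 0 + tau * zpart w i 0 - c| < c].

Definition Eoset (lambda tau : R) (w : 'cV[R]_(n + m)) : {set 'I_m} :=
  let c := Num.sqrt (tau * lambda / 2) in
  [set i | ((A *m xpart w + b) i 0 == 0) && (`|tau * zpart w i 0 - c| == c)].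

Definition Tset lambda tau w : {set 'I_m} := Sset lambda tau w :|: Eoset lambda tau w.

Definition Dind (G : {set 'I_m}) : 'M[R]_m := diag_mx (\row_i (i \in G)%:R).

(* F(w;G), written in the coordinates of w = (x;z): the x-block is
   grad f(x) + A_G^T z_G; the entry of index i of the z-block is
   A_i x + b_i if i \in G and z_i otherwise. *)
Definition Fmap (grad : 'cV[R]_n -> 'cV[R]_n) (G : {set 'I_m}) (w : 'cV[R]_(n + m))
  : 'cV[R]_(n + m) :=
  col_mx (grad (xpart w) + A^T *m (Dind G *m zpart w))
         (\col_i (if i \in G then (A *m xpart w + b) i 0 else zpart w i 0)).

Definition JFmap (hess : 'cV[R]_n -> 'M[R]_n) (mu : R) (G : {set 'I_m})
  (w : 'cV[R]_(n + m)) : 'M[R]_(n + m) :=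
  block_mx (hess (xpart w)) (A^T *m Dind G)
           (Dind G *m A) (- mu *: Dind G + (1%:M - Dind G)).

(* One Newton step: state = (w^k, mu_{k-1}) *)
Section Newton.
Variables (grad : 'cV[R]_n -> 'cV[R]_n) (hess : 'cV[R]_n -> 'M[R]_n)
          (lambda tau rho alpha : R).

Definition Tk (w : 'cV[R]_(n + m)) := Tset lambda tau w.
Definition muk (w : 'cV[R]_(n + m)) (muprev : R) : R :=
  Num.min (alpha * muprev) (rho * enorm (Fmap grad (Tk w) w)).
Definition Jk w muprev := JFmap hess (muk w muprev) (Tk w) w.
Definition dk w muprev : 'cV[R]_(n + m) :=
  - (invmx (Jk w muprev) *m Fmap grad (Tk w) w).

Fixpoint newton (w0 : 'cV[R]_(n + m)) (mum1 : R) (k : nat) : 'cV[R]_(n + m) * R :=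
  match k with
  | 0 => (w0, mum1)
  | k'.+1 => let s := newton w0 mum1 k' in
             (s.1 + dk s.1 s.2, muk s.1 s.2)
  end.

Definition wseq w0 mum1 k := (newton w0 mum1 k).1.
Definition dseq w0 mum1 k := dk (newton w0 mum1 k).1 (newton w0 mum1 k).2.
Definition Jseq w0 mum1 k := Jk (newton w0 mum1 k).1 (newton w0 mum1 k).2.
Definition Fseq w0 mum1 k := Fmap grad (Tk (wseq w0 mum1 k)) (wseq w0 mum1 k).
End Newton.

End Defs.

Definition log2 {R : realType} (x : R) : R := ln x / ln 2.

(* Main.v *)
(** The multiplier [zs] vanishes where [A xs + b] does not, and [tau < taustar]
    keeps the non-boundary inequalities defining [T] strict at the solution, so
    near [(xs; zs)] every index set [T_k] lies in [Gstar] and contains the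
    support of [zs].  Hence the solution is a common zero of all the maps [F(.; T_k)], and
    since [T_k] is a subset of [Gstar] their Jacobians there expand norms by at
    least [2 cs] and at most [Cs / 2].  The Lipschitz bound on the Hessian and
    [mu_k <= rho |F|] then make each iteration a perturbed Newton step towards
    this common zero, however [T_k] varies: it maps the error [e] to at most
    [(L e^2 + mu_k e) / cs <= (L + rho Cs) e^2 / cs], while
    [cs e <= |F| <= Cs e]. *)

Require Import Defs.
From HB Require Import structures.
From mathcomp Require Import all_boot all_order all_algebra.
From mathcomp Require Import all_classical all_reals all_analysis.
From mathcomp Require Import ring lra.
Import Order.TTheory GRing.Theory Num.Theory.
Import numFieldNormedType.Exports.
Local Open Scope classical_set_scope.
Local Open Scope ring_scope.

Set Implicit Arguments. Unset Strict Implicit. Unset Printing Implicit Defensive.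

(** * Euclidean norm: Cauchy-Schwarz, operator bounds and invertibility criteria *)

Section Enorm.
Variable R : realType.
Implicit Types k p q : nat.

Definition dotv k (u v : 'cV[R]_k) : R := \sum_i u i 0 * v i 0.

Lemma enorm_sq k (v : 'cV[R]_k) : enorm v ^+ 2 = \sum_i v i 0 ^+ 2.
Proof. by rewrite /enorm sqr_sqrtr// sumr_ge0// => i _; exact: sqr_ge0. Qed.

Lemma enorm_sq_dot k (v : 'cV[R]_k) : enorm v ^+ 2 = dotv v v.
Proof. by rewrite enorm_sq; apply: eq_bigr => i _; rewrite expr2. Qed.

Lemma enorm_ge0 k (v : 'cV[R]_k) : 0 <= enorm v.
Proof. exact: sqrtr_ge0. Qed.

Lemma dotvC k (u v : 'cV[R]_k) : dotv u v = dotv v u.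
Proof. by apply: eq_bigr => i _; rewrite mulrC. Qed.

Lemma dotvDr k (u v w : 'cV[R]_k) : dotv u (v + w) = dotv u v + dotv u w.
Proof. by rewrite -big_split; apply: eq_bigr => i _; rewrite mxE mulrDr. Qed.

Lemma dotvZr k (u v : 'cV[R]_k) a : dotv u (a *: v) = a * dotv u v.
Proof. by rewrite /dotv big_distrr; apply: eq_bigr => i _; rewrite mxE mulrCA. Qed.

Lemma dotvDl k (u v w : 'cV[R]_k) : dotv (v + w) u = dotv v u + dotv w u.
Proof. by rewrite dotvC dotvDr !(dotvC u). Qed.

Lemma dotvZl k (u v : 'cV[R]_k) a : dotv (a *: v) u = a * dotv v u.
Proof. by rewrite dotvC dotvZr (dotvC u). Qed.

Lemma enorm_eq0 k (v : 'cV[R]_k) : enorm v = 0 -> v = 0.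
Proof.
move=> v0; have /eqP : \sum_i v i 0 ^+ 2 = 0 by rewrite -enorm_sq v0 expr0n.
rewrite psumr_eq0 => [/allP h|i _]; last exact: sqr_ge0.
apply/matrixP => i j; rewrite ord1 mxE; apply/eqP.
by have := h i (mem_index_enum _); rewrite sqrf_eq0.
Qed.

Lemma enorm0 k : enorm (0 : 'cV[R]_k) = 0.
Proof. by rewrite /enorm big1 ?sqrtr0// => i _; rewrite mxE expr0n. Qed.

Lemma enormZ k a (v : 'cV[R]_k) : enorm (a *: v) = `|a| * enorm v.
Proof.
rewrite /enorm -sqrtr_sqr -sqrtrM ?sqr_ge0//; congr Num.sqrt.
by rewrite big_distrr; apply: eq_bigr => i _; rewrite mxE exprMn.
Qed.

Lemma enormN k (v : 'cV[R]_k) : enorm (- v) = enorm v.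
Proof. by rewrite -scaleN1r enormZ normrN1 mul1r. Qed.

(** Cauchy-Schwarz: the squared norm of [|v|^2 u - <u,v> v] is [|v|^2] times
    [(|u| |v|)^2 - <u,v>^2]. *)
Lemma dotv_le k (u v : 'cV[R]_k) : dotv u v <= enorm u * enorm v.
Proof.
have [v0|v0] := eqVneq (enorm v) 0.
  rewrite (enorm_eq0 v0) enorm0 mulr0 /dotv big1// => i _.
  by rewrite mxE mulr0.
have vp : 0 < enorm v by rewrite lt_def v0 enorm_ge0.
have : 0 <= enorm (enorm v ^+ 2 *: u + (- dotv u v) *: v) ^+ 2 by exact: sqr_ge0.
rewrite enorm_sq_dot !(dotvDl, dotvDr, dotvZl, dotvZr) (dotvC v u) -!enorm_sq_dot.
set a := enorm u; set c := enorm v in vp *; set t := dotv u v => h.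
have {h} : 0 <= c ^+ 2 * ((a * c) ^+ 2 - t ^+ 2) by move: h; lra.
rewrite pmulr_rge0 ?exprn_gt0// subr_ge0 => h.
have ac : 0 <= a * c by rewrite mulr_ge0 ?enorm_ge0.
rewrite (le_trans (ler_norm t))// -(ger0_norm ac) -ler_sqr ?nnegrE//.
by rewrite !real_normK ?num_real.
Qed.

Lemma enormD k (u v : 'cV[R]_k) : enorm (u + v) <= enorm u + enorm v.
Proof.
rewrite -ler_sqr ?nnegrE ?addr_ge0 ?enorm_ge0// enorm_sq_dot !(dotvDl, dotvDr).
rewrite (dotvC v u) -!enorm_sq_dot sqrrD; have := dotv_le u v; lra.
Qed.

Lemma enormB k (u v : 'cV[R]_k) : enorm u - enorm v <= enorm (u - v).
Proof. by rewrite lerBlDr -{1}(subrK v u) enormD. Qed.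

Lemma enorm_col_sq p q (u : 'cV[R]_p) (v : 'cV[R]_q) :
  enorm (col_mx u v) ^+ 2 = enorm u ^+ 2 + enorm v ^+ 2.
Proof.
rewrite !enorm_sq big_split_ord; congr (_ + _); apply: eq_bigr => i _.
  by rewrite col_mxEu.
by rewrite col_mxEd.
Qed.

Lemma enorm_col0 p q (u : 'cV[R]_p) : enorm (col_mx u (0 : 'cV[R]_q)) = enorm u.
Proof.
apply/eqP; rewrite -(@eqrXn2 _ 2) ?enorm_ge0//.
by rewrite enorm_col_sq enorm0 expr0n addr0.
Qed.

Lemma enorm_0col p q (u : 'cV[R]_q) : enorm (col_mx (0 : 'cV[R]_p) u) = enorm u.
Proof.
apply/eqP; rewrite -(@eqrXn2 _ 2) ?enorm_ge0//.
by rewrite enorm_col_sq enorm0 expr0n add0r.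
Qed.

Lemma enorm_col_le p q (u : 'cV[R]_p) (v : 'cV[R]_q) :
  enorm (col_mx u v) <= enorm u + enorm v.
Proof.
have -> : col_mx u v = col_mx u 0 + col_mx 0 v by rewrite add_col_mx addr0 add0r.
by rewrite (le_trans (enormD _ _))// enorm_col0 enorm_0col.
Qed.

Lemma enorm_usub p q (w : 'cV[R]_(p + q)) : enorm (usubmx w) <= enorm w.
Proof.
rewrite -ler_sqr ?nnegrE ?enorm_ge0// -{2}(vsubmxK w) enorm_col_sq lerDl.
exact: sqr_ge0.
Qed.

Lemma enorm_dsub p q (w : 'cV[R]_(p + q)) : enorm (dsubmx w) <= enorm w.
Proof.
rewrite -ler_sqr ?nnegrE ?enorm_ge0// -{2}(vsubmxK w) enorm_col_sq lerDr.
exact: sqr_ge0.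
Qed.

Lemma abs_le_enorm k (v : 'cV[R]_k) i : `|v i 0| <= enorm v.
Proof.
rewrite -ler_sqr ?nnegrE ?enorm_ge0// enorm_sq real_normK ?num_real//.
by rewrite (bigD1 i)//= lerDl sumr_ge0// => j _; exact: sqr_ge0.
Qed.

(** Limits of vectors are taken in the sup norm; this turns Euclidean estimates into convergence. *)
Lemma mx_norm_le_enorm k (v : 'cV[R]_k) : `|v| <= enorm v.
Proof.
rewrite [leLHS]/Num.norm/= mx_normrE; apply/bigmax_leP; split; first exact: enorm_ge0.
by move=> [i j] _ /=; rewrite ord1 abs_le_enorm.
Qed.

(** The Frobenius norm serves as [B], by Cauchy-Schwarz on each row. Some finite bound is what makes
    the supremum in [specnorm] an actual upper bound. *)
Lemma enorm_mulmx_bounded p q (M : 'M[R]_(p, q)) :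
  exists2 B, 0 <= B & forall v, enorm (M *m v) <= B * enorm v.
Proof.
pose r i := (row i M)^T.
exists (Num.sqrt (\sum_i enorm (r i) ^+ 2)); first exact: sqrtr_ge0.
move=> v; rewrite -ler_sqr ?nnegrE ?mulr_ge0 ?enorm_ge0 ?sqrtr_ge0//.
rewrite exprMn [X in X * _]sqr_sqrtr ?sumr_ge0// => [|i _]; last exact: sqr_ge0.
rewrite enorm_sq mulr_suml; apply: ler_sum => i _ /=.
have -> : (M *m v) i 0 = dotv (r i) v.
  by rewrite mxE; apply: eq_bigr => j _; rewrite !mxE.
rewrite -exprMn -[X in X <= _]real_normK ?num_real//.
rewrite ler_sqr ?nnegrE ?mulr_ge0 ?enorm_ge0//.
rewrite ler_norml dotv_le andbT lerNl.
by rewrite -mulN1r -dotvZl scaleN1r (le_trans (dotv_le _ _))// enormN.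
Qed.

Lemma enorm_mulmx_le p q (M : 'M[R]_(p, q)) v :
  enorm (M *m v) <= specnorm M * enorm v.
Proof.
have [v0|v0] := eqVneq (enorm v) 0.
  by rewrite v0 (enorm_eq0 v0) mulmx0 enorm0 mulr0.
have vp : 0 < enorm v by rewrite lt_def v0 enorm_ge0.
rewrite -ler_pdivrMr//.
have -> : enorm (M *m v) / enorm v = enorm (M *m ((enorm v)^-1 *: v)).
  by rewrite -scalemxAr enormZ ger0_norm ?invr_ge0 ?enorm_ge0// mulrC.
apply: ub_le_sup.
  have [B B0 MB] := enorm_mulmx_bounded M.
  exists B => _ [u /= u1 <-]; rewrite (le_trans (MB u))//.
  by rewrite ler_piMr.
exists ((enorm v)^-1 *: v) => //=.
by rewrite enormZ ger0_norm ?invr_ge0 ?enorm_ge0// mulVf.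
Qed.

Lemma smin_mulmx_le k (M : 'M[R]_k) v : smin M * enorm v <= enorm (M *m v).
Proof.
have [v0|v0] := eqVneq (enorm v) 0; first by rewrite v0 mulr0 enorm_ge0.
have vp : 0 < enorm v by rewrite lt_def v0 enorm_ge0.
rewrite -ler_pdivlMr//.
have -> : enorm (M *m v) / enorm v = enorm (M *m ((enorm v)^-1 *: v)).
  by rewrite -scalemxAr enormZ ger0_norm ?invr_ge0 ?enorm_ge0// mulrC.
apply: ge_inf; first by exists 0 => _ [u _ <-]; exact: enorm_ge0.
exists ((enorm v)^-1 *: v) => //=.
by rewrite enormZ ger0_norm ?invr_ge0 ?enorm_ge0// mulVf.
Qed.

(** An expanding matrix has trivial kernel; every Newton matrix is shown nonsingular this way. *)
Lemma unitmx_enorm_ge k (M : 'M[R]_k) c : 0 < c ->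
  (forall v, c * enorm v <= enorm (M *m v)) -> M \in unitmx.
Proof.
move=> c0 Mc; rewrite -unitmx_tr -row_free_unit -kermx_eq0.
apply/eqP/row_matrixP => i; rewrite row0.
set u := row i _; have uM : u *m M^T = 0.
  by apply/sub_kermxP; rewrite row_sub.
have : M *m u^T = 0 by apply: trmx_inj; rewrite trmx_mul trmxK trmx0.
move=> Mu; have := Mc u^T; rewrite Mu enorm0 pmulr_rle0// => u0.
apply: trmx_inj; rewrite trmx0; apply: enorm_eq0.
by apply/eqP; rewrite eq_le u0 enorm_ge0.
Qed.

(** If [u] annihilates the Gram matrix, then [|u M|^2 = u M M^T u^T = 0], so [u] annihilates [M]. It
    makes the [invmx] inside [pstar] a true inverse. *)
Lemma row_free_gram_unit p q (M : 'M[R]_(p, q)) :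
  row_free M -> M *m M^T \in unitmx.
Proof.
move=> fM; rewrite -row_free_unit -kermx_eq0.
apply/eqP/row_matrixP => i; rewrite row0.
set u := row i _; have uM : u *m (M *m M^T) = 0.
  by apply/sub_kermxP; rewrite row_sub.
apply/eqP; rewrite -(mulmx_free_eq0 u fM); apply/eqP/trmx_inj.
rewrite trmx0; apply: enorm_eq0; apply/eqP; rewrite -sqrf_eq0 enorm_sq_dot.
have -> : dotv (u *m M)^T (u *m M)^T = (u *m (M *m M^T) *m u^T) 0 0.
  rewrite mulmxA -mulmxA -trmx_mul [RHS]mxE.
  by apply: eq_bigr => j _; congr (_ * _); rewrite mxE.
by rewrite uM mul0mx mxE.
Qed.

End Enorm.

(** * A mean value inequality for vector fields *)

Section LinearApproximation.
Variable R : realType.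

Lemma is_derive_line n (F : 'cV[R]_n -> R) (x v : 'cV[R]_n) (t : R) :
  derivable F (x + t *: v) v ->
  is_derive t 1 (fun s : R => F (x + s *: v)) ('D_v F (x + t *: v)).
Proof.
have quotE : (fun h : R => h^-1 *: (F (x + (h *: (1 : R) + t) *: v) - F (x + t *: v)))
    = (fun h : R => h^-1 *: (F (h *: v + (x + t *: v)) - F (x + t *: v))).
  apply/funext => h; congr (_ *: (F _ - _)).
  by rewrite scalerDl [h *: 1]mulr1 addrCA.
by move=> dF; apply: DeriveDef; rewrite /derivable /derive /= quotE.
Qed.

(** The mean value theorem is scalar, so [g] is paired along the segment with the error vector [u]
    itself. [M] is left free so that the linearisation may be based at either end. *)
Lemma linear_approx_le n (g : 'cV[R]_n -> 'cV[R]_n) (h : 'cV[R]_n -> 'M[R]_n)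
    (M : 'M[R]_n) (x y : 'cV[R]_n) (K : R) :
  (forall z, differentiable g z) -> (forall z v, 'D_v g z = h z *m v) ->
  (forall t, 0 <= t <= 1 ->
    enorm ((h (x + t *: (y - x)) - M) *m (y - x)) <= K) ->
  enorm (g y - g x - M *m (y - x)) <= K.
Proof.
move=> dg hg hK; set v := y - x in hK *; set u := _ - _.
(* From here [u] is a constant vector; its value is recalled only through [uE]. *)
have uE : u = g y - g x - M *m v by []; clearbody u.
pose phi (t : R) := dotv u (g (x + t *: v)).
pose dphi (t : R) := dotv u (h (x + t *: v) *m v).
have dphiE (t : R) : is_derive t 1 phi (dphi t).
  have -> : phi = \sum_i (fun s : R => u i 0 *: g (x + s *: v) i 0).
    by apply/funext => s; rewrite fct_sumE.
  apply: is_derive_sum => i; apply: is_deriveZ.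
  have dgv : derivable g (x + t *: v) v by exact: diff_derivable.
  have -> : (h (x + t *: v) *m v) i 0 = 'D_v (fun z => g z i 0) (x + t *: v).
    by rewrite -hg derive_mx// mxE.
  apply: (@is_derive_line n (fun z => g z i 0)).
  by have /derivable_mxP := dgv; exact.
have [|t t01] := MVT_segment (@ler01 R) (fun t _ => dphiE t).
  apply: continuous_subspaceT => t; apply: differentiable_continuous.
  by apply/derivable1_diffP; have [] := dphiE t.
rewrite subr0 mulr1 /phi /dphi scale1r scale0r addr0 [x + v]addrC subrK => e.
have {}hK : enorm ((h (x + t *: v) - M) *m v) <= K.
  by apply: hK; move: t01; rewrite in_itv.
(* Subtracting [<u, M v>] from the mean value identity leaves [|u|^2]; Cauchy-Schwarz then allows
   one factor [|u|] to be cancelled. *)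
have uu : enorm u ^+ 2 = dotv u ((h (x + t *: v) - M) *m v).
  rewrite mulmxBl -[X in _ + X]scaleN1r dotvDr dotvZr -e enorm_sq_dot {2}uE.
  rewrite -(scaleN1r (g x)) -(scaleN1r (M *m v)) !dotvDr !dotvZr.
  by rewrite mulN1r.
have : enorm u ^+ 2 <= enorm u * K.
  by rewrite uu (le_trans (dotv_le _ _))// ler_wpM2l ?enorm_ge0.
have [u0|u0] := eqVneq (enorm u) 0.
  by rewrite u0 => _; rewrite (le_trans (enorm_ge0 _) hK).
by rewrite expr2 ler_pM2l// lt_def u0 enorm_ge0.
Qed.

End LinearApproximation.

(** The prox objective is separable: a competitor differing from [y] only at [i] isolates one scalar
    problem. *)
Lemma in_prox_coord (R : realType) k (a : R) (z y : 'cV[R]_k) i (t : R) : in_prox a z y ->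
  (y i 0 - z i 0) ^+ 2 / 2 + a * (0 < y i 0)%R%:R
    <= (t - z i 0) ^+ 2 / 2 + a * (0 < t)%R%:R.
Proof.
pose y' : 'cV[R]_k := \col_j (if j == i then t else y j 0).
have y'i : y' i 0 = t by rewrite mxE eqxx.
have y'j j : j != i -> y' j 0 = y j 0 by move=> /negPf ji; rewrite mxE ji.
have memE (x : 'cV[R]_k) j : (j \in [set l | 0 < x l 0]) = (0 < x j 0).
  by rewrite /in_mem /mem /= /in_set asboolb.
have l0E (x : 'cV[R]_k) :
    l0pos x = (0 < x i 0)%R%:R + \sum_(j | j != i) (0 < x j 0)%R%:R.
  rewrite /l0pos -sum1_card natr_sum big_mkcond (bigD1 i)//=; congr (_ + _).
    by rewrite memE; case: ifP.
  by apply: eq_bigr => j _; rewrite memE; case: ifP.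
have sqE (x : 'cV[R]_k) : enorm (x - z) ^+ 2
    = (x i 0 - z i 0) ^+ 2 + \sum_(j | j != i) (x j 0 - z j 0) ^+ 2.
  rewrite enorm_sq (bigD1 i)//= !mxE; congr (_ + _).
  by apply: eq_bigr => j _; rewrite !mxE.
move=> /(_ y'); rewrite !l0E !sqE y'i.
have -> : \sum_(j | j != i) (y' j 0 - z j 0) ^+ 2
    = \sum_(j | j != i) (y j 0 - z j 0) ^+ 2.
  by apply: eq_bigr => j /y'j ->.
have -> : \sum_(j | j != i) (0 < y' j 0)%R%:R
    = \sum_(j | j != i) (0 < y j 0)%R%:R :> R.
  by apply: eq_bigr => j /y'j ->.
set S := \sum_(_ | _) _; set N := \sum_(_ | _) _; lra.
Qed.

(** * Consequences of P-stationarity and the index sets near the solution *)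

Section Stationarity.
Variables (R : realType) (n m : nat) (A : 'M[R]_(m, n)) (b : 'cV[R]_m).

Definition subv k (G : {set 'I_k}) (z : 'cV[R]_k) : 'cV[R]_#|G| :=
  \col_i z (enum_val i) 0.

Lemma Asub_mulmx G x : Asub A G *m x = subv G (A *m x).
Proof.
by apply/matrixP => i j; rewrite ord1 !mxE; apply: eq_bigr => l _; rewrite mxE.
Qed.

Lemma Dind_mulmx k (G : {set 'I_k}) (z : 'cV[R]_k) i :
  (Dind R G *m z) i 0 = if i \in G then z i 0 else 0.
Proof. by rewrite mul_diag_mx !mxE; case: ifP; rewrite ?mul1r ?mul0r. Qed.

(** Bridge between the two encodings of restriction to [G]: the diagonal mask of [Fmap] and [JFmap],
    and the submatrix of [Hmat]. *)
Lemma trmx_mul_Dind G z : A^T *m (Dind R G *m z) = (Asub A G)^T *m subv G z.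
Proof.
apply/matrixP => j l; rewrite ord1 !mxE {l}.
transitivity (\sum_(i in G) A i j * z i 0).
  rewrite [RHS]big_mkcond; apply: eq_bigr => i _.
  by rewrite Dind_mulmx mxE; case: ifP; rewrite ?mulr0.
by rewrite big_enum_val; apply: eq_bigr => i _; rewrite !mxE.
Qed.

Lemma Dind_id k (G : {set 'I_k}) (z : 'cV[R]_k) :
  (forall i, i \notin G -> z i 0 = 0) -> Dind R G *m z = z.
Proof.
move=> zG; apply/matrixP => i j; rewrite ord1 Dind_mulmx.
by case: ifPn => // /zG ->.
Qed.

(** As [zs] is supported in [Gstar], the gradient is [- A_G^T z_G] and the Gram matrix cancels. This
    converts [tau2] into a bound on the multiplier. *)
Lemma pstar_eq (grad : 'cV[R]_n -> 'cV[R]_n) xs zs :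
  grad xs + A^T *m zs = 0 -> row_free (Asub A (Gstar A b xs)) ->
  (forall i, (A *m xs + b) i 0 != 0 -> zs i 0 = 0) ->
  pstar A b grad xs = subv (Gstar A b xs) zs.
Proof.
move=> gz0 fA z0; rewrite /pstar; set G := Gstar A b xs in fA *.
have zG : Dind R G *m zs = zs.
  by apply: Dind_id => i; rewrite inE => /z0.
have -> : grad xs = - ((Asub A G)^T *m subv G zs).
  by apply/eqP; rewrite -addr_eq0 -trmx_mul_Dind zG gz0.
rewrite mulmxN opprK mulmxA -(mulmxA (invmx _)) mulVmx ?mul1mx//.
exact: row_free_gram_unit.
Qed.

Lemma continuous_mulmx_coord p q (M : 'M[R]_(p, q)) i (w : 'cV[R]_q) :
  (M *m v) i 0 @[v --> w] --> (M *m w) i 0.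
Proof.
have -> : (fun v : 'cV[R]_q => (M *m v) i 0) = fun v => \sum_j M i j * v j 0.
  by apply/funext => v; rewrite mxE.
have cj j : continuous (fun v : 'cV[R]_q => M i j * v j 0).
  move=> v; exact: (cvgMl_tmp (@coord_continuous R q 1 j 0 v)).
have sc := @continuous_big R _ +%R 0 _ (@add_continuous R) _ (index_enum _) _
  (fun j (_ : xpredT j) => cj j).
by rewrite mxE; exact: sc.
Qed.

Variables (grad : 'cV[R]_n -> 'cV[R]_n) (lambda tau : R).
Variables (xs : 'cV[R]_n) (zs : 'cV[R]_m).
Hypotheses (lambda0 : 0 < lambda) (tau0 : 0 < tau).
Hypothesis stat : Pstationary A b grad lambda tau xs zs.
Hypothesis tauE : (tau%:E < taustar A b grad lambda xs)%E.
Hypothesis fA : row_free (Asub A (Gstar A b xs)).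

Let y := A *m xs + b.
Let c := Num.sqrt (tau * lambda / 2).

Let c_gt0 : 0 < c.
Proof. by rewrite sqrtr_gt0 !mulr_gt0. Qed.

Let c_sq : c ^+ 2 = tau * lambda / 2.
Proof. by rewrite sqr_sqrtr// ltW// !mulr_gt0. Qed.

Lemma stationary_compl i : y i 0 != 0 -> zs i 0 = 0.
Proof.
move=> yi0; have [_ pr] := stat.
(* Competitors: the prox argument [u + t] and [0]. The first forces [t = 0] except when
   [u < 0 < u + t]; there [|u + t| < |t|] contradicts the second. *)
have := in_prox_coord i (y i 0 + tau * zs i 0) pr.
have := in_prox_coord i 0 pr.
have -> : (A *m xs + b + tau *: zs) i 0 = y i 0 + tau * zs i 0 by rewrite !mxE.
rewrite -/y; set t := tau * zs i 0; set u := y i 0 in yi0 *; rewrite ltxx mulr0 addr0.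
rewrite (_ : u - (u + t) = - t); last by ring.
rewrite subrr expr0n mul0r !add0r !sqrrN => h0 h1.
have la : 0 < tau * lambda by rewrite mulr_gt0.
suff t0 : t = 0 by apply/eqP; rewrite -(mulrI_eq0 _ (lregP (lt0r_neq0 tau0))) -/t t0.
apply/eqP; rewrite -sqrf_eq0 eq_le sqr_ge0 andbT.
case: (ltgtP u 0) yi0 h0 h1 => // u0 _; rewrite /= ?mulr0n ?mulr1n ?mulr0 ?mulr1 ?addr0.
- case: ltP => ut; rewrite /= ?mulr0n ?mulr1n ?mulr0 ?mulr1 => h0 h1; last lra.
  nra.
- case: ltP => ut; rewrite /= ?mulr0n ?mulr1n ?mulr0 ?mulr1 => h0 h1; lra.
Qed.

Lemma stationary_ge0 i : y i 0 = 0 -> 0 <= zs i 0.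
Proof.
move=> yi0; have [_ pr] := stat.
have := in_prox_coord i (y i 0 + tau * zs i 0) pr.
have -> : (A *m xs + b + tau *: zs) i 0 = y i 0 + tau * zs i 0 by rewrite !mxE.
rewrite -/y yi0 !add0r subrr expr0n mul0r !add0r sqrrN ltxx mulr0 addr0.
rewrite pmulr_rgt0//; case: ltP => [/ltW//|_]; rewrite mulr0 => h.
have : (tau * zs i 0) ^+ 2 == 0 by rewrite eq_le sqr_ge0 andbT; lra.
by rewrite sqrf_eq0 mulf_eq0 gt_eqF//= => /eqP ->.
Qed.

(** This is [tau < tau1], since [(2c)^2 = 2 tau lambda]. *)
Lemma stationary_gap i : 0 < y i 0 -> 2 * c < y i 0.
Proof.
move=> yi; rewrite -ltr_sqr ?nnegrE; [|by rewrite mulr_ge0// ltW|exact: ltW].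
rewrite exprMn c_sq; move: tauE; rewrite /taustar lt_min => /andP[+ _].
move=> /lt_le_trans => /(_ ((y i 0) ^+ 2 / (2 * lambda))%:E).
rewrite lte_fin ltr_pdivlMr ?mulr_gt0// => h.
have : tau * (2 * lambda) < y i 0 ^+ 2.
  by apply: h; apply: ereal_inf_lbound; exists i.
lra.
Qed.

(** This is [tau < tau2]: by [pstar_eq] it reads [tau z_i^2 < 2 lambda], that is
    [(tau z_i)^2 < (2c)^2]. *)
Lemma stationary_mult_lt i : y i 0 = 0 -> tau * zs i 0 < 2 * c.
Proof.
move=> yi; have [z0|z0] := eqVneq (zs i 0) 0; first by rewrite z0 mulr0 mulr_gt0.
have iG : i \in Gstar A b xs by rewrite inE; apply/eqP.
have [gz _] := stat.
have pE := pstar_eq gz fA stationary_compl.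
move: tauE; rewrite /taustar lt_min => /andP[_].
rewrite /tau2 pE; case: ifPn => [/orP[/eqP G0|/eqP s0] _|_].
- by move: iG; rewrite G0 inE.
- have /matrixP/(_ (enum_rank_in iG i) 0) := s0.
  by rewrite !mxE enum_rankK_in// => z00; rewrite z00 eqxx in z0.
rewrite lte_fin; set M := \big[_/_]_ _ _ => h.
have zM : zs i 0 ^+ 2 <= M.
  have := le_bigmax 0 (fun j => subv (Gstar A b xs) zs j 0 ^+ 2) (enum_rank_in iG i).
  by rewrite /= mxE enum_rankK_in.
have z2 : 0 < zs i 0 ^+ 2 by rewrite exprn_even_gt0.
have M0 : 0 < M by exact: lt_le_trans zM.
rewrite ltr_pdivlMr// in h.
rewrite (le_lt_trans (ler_norm _))// -ltr_sqr ?nnegrE//; last first.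
  by rewrite mulr_ge0// ltW.
rewrite real_normK ?num_real// !exprMn c_sq.
have : tau * (tau * zs i 0 ^+ 2) < tau * (2 * lambda).
  by rewrite ltr_pM2l// (le_lt_trans _ h)// ler_pM2l.
lra.
Qed.

Let ws := col_mx xs zs.

Lemma Tset_near : exists2 e, 0 < e & forall w, enorm (w - ws) < e ->
  Tset A b lambda tau w \subset Gstar A b xs /\
  forall i, i \notin Tset A b lambda tau w -> zs i 0 = 0.
Proof.
pose yw (w : 'cV[R]_(n + m)) i := (A *m xpart w + b) i 0.
have yc i : (yw w i @[w --> ws] --> y i 0).
  have -> : yw ^~ i = fun w => (row_mx A 0 *m w) i 0 + b i 0.
    apply/funext => w; rewrite /yw mxE; congr (_ + _).
    by rewrite -[in RHS](vsubmxK w) mul_row_col mul0mx addr0.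
  have -> : y i 0 = (row_mx A 0 *m ws) i 0 + b i 0.
    by rewrite mul_row_col mul0mx addr0 mxE.
  exact: (cvgD (@continuous_mulmx_coord m (n + m) (row_mx A 0) i ws) (cvg_cst (b i 0))).
have zc i : (zpart w i 0 @[w --> ws] --> zs i 0).
  have -> : (fun w : 'cV[R]_(n + m) => zpart w i 0) = fun w => w (rshift n i) 0.
    by apply/funext => w; rewrite mxE.
  have -> : zs i 0 = ws (rshift n i) 0 by rewrite col_mxEd.
  exact: (@coord_continuous R (n + m) 1 (rshift n i) 0 ws).
pose h (w : 'cV[R]_(n + m)) i := yw w i + tau * zpart w i 0 - c.
have hc i : (`|h w i| @[w --> ws] --> `|y i 0 + tau * zs i 0 - c|).
  exact: (cvg_norm (cvgB (cvgD (yc i) (cvgMl_tmp (zc i))) (cvg_cst c))).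
have keyi (i : 'I_m) : \forall w \near ws,
    (i \in Tset A b lambda tau w -> y i 0 = 0) /\
    (i \notin Tset A b lambda tau w -> zs i 0 = 0).
  have [yi|yi] := eqVneq (y i 0) 0.
    (* An index where both [y] and [zs] vanish may enter or leave [T] freely. If [zs i 0 > 0], then
       [0 < tau z_i < 2c] puts [i] in [Sset] for all nearby [w]. *)
    have [zi|zi] := eqVneq (zs i 0) 0; first by apply: (@nearW _ (nbhs ws)) => w; split.
    have : `|y i 0 + tau * zs i 0 - c| < c.
      have zi0 : 0 < zs i 0 by rewrite lt_def zi stationary_ge0.
      have tz : 0 < tau * zs i 0 by rewrite mulr_gt0.
      have := stationary_mult_lt yi.
      by rewrite yi add0r ltr_norml => ?; apply/andP; split; lra.
    move=> /(cvgr_lt _ (hc i)); apply: (@filterS _ (nbhs ws)) => w hw; split=> //.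
    by rewrite inE negb_or inE hw.
  have zi := stationary_compl yi.
  have : c < `|y i 0 + tau * zs i 0 - c|.
    rewrite zi mulr0 addr0 ltr_normr; have := c_gt0.
    case: (ltgtP (y i 0) 0) yi => // yi _ c0.
      by apply/orP; right; lra.
    by apply/orP; left; have := stationary_gap yi; lra.
  move=> /(cvgr_gt _ (hc i)) hgt.
  (* The strict inequality [hgt] excludes [i] from [Sset]; nonvanishing of [yw] excludes it from
     [Eoset]. *)
  have ygt : \forall w \near ws, 0 < `|yw w i|.
    by apply: (cvgr_gt _ (cvg_norm (yc i))); rewrite normr_gt0.
  apply: (@filterS2 _ (nbhs ws)) hgt ygt => w hw yw0; split=> //.
  rewrite inE => /orP[]; rewrite inE.
    by rewrite -/(yw w i) -/(h w i) -/c ltNge (ltW hw).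
  by rewrite -/(yw w i) -normr_eq0 gt_eqF.
have /nbhs_ballP[e /= e0 he] := filter_forall (nbhs_filter ws) keyi; exists e => // w we.
have /he hw : ball ws e w.
  split=> // k l; rewrite ord1 /ball/= distrC (le_lt_trans _ we)//.
  by have := abs_le_enorm (w - ws) k; rewrite !mxE.
split; last by move=> i; have [] := hw i.
by apply/fintype.subsetP => i; have [+ _] := hw i => /[apply] yi; rewrite inE -/y yi.
Qed.

End Stationarity.

(** * Bounds on the unregularised Jacobian at the solution *)

Section LocalAnalysis.
Variables (R : realType) (n m : nat) (A : 'M[R]_(m, n)) (b : 'cV[R]_m).
Variable hess : 'cV[R]_n -> 'M[R]_n.

Lemma enorm_subv_sq k (G : {set 'I_k}) (z : 'cV[R]_k) :
  enorm (subv G z) ^+ 2 = \sum_(i in G) z i 0 ^+ 2.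
Proof.
by rewrite enorm_sq [RHS]big_enum_val; apply: eq_bigr => i _; rewrite mxE.
Qed.

Lemma enorm_Dind_le k (G : {set 'I_k}) (z : 'cV[R]_k) :
  enorm (Dind R G *m z) <= enorm z.
Proof.
rewrite -ler_sqr ?nnegrE ?enorm_ge0// !enorm_sq; apply: ler_sum => i _.
by rewrite Dind_mulmx; case: ifP => // _; rewrite expr0n sqr_ge0.
Qed.

Lemma Hmat_enorm_sq xs G (vx : 'cV[R]_n) (vz : 'cV[R]_m) :
  enorm (Hmat A hess xs G *m col_mx vx (subv G vz)) ^+ 2 =
  enorm (hess xs *m vx + A^T *m (Dind R G *m vz)) ^+ 2
    + \sum_(i in G) (A *m vx) i 0 ^+ 2.
Proof.
rewrite mul_block_col mul0mx addr0 enorm_col_sq -trmx_mul_Dind Asub_mulmx.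
by rewrite enorm_subv_sq.
Qed.

Lemma JFmap_mulmx mu G w (vx : 'cV[R]_n) (vz : 'cV[R]_m) :
  JFmap A hess mu G w *m col_mx vx vz =
  col_mx (hess (xpart w) *m vx + A^T *m (Dind R G *m vz))
    (\col_i (if i \in G then (A *m vx) i 0 - mu * vz i 0 else vz i 0)).
Proof.
rewrite mul_block_col -!mulmxA; congr col_mx.
apply/matrixP => i j; rewrite ord1 {j} [RHS]mxE mxE Dind_mulmx.
have -> : ((- mu *: Dind R G + (1%:M - Dind R G)) *m vz) i 0
    = - mu * (Dind R G *m vz) i 0 + (vz i 0 - (Dind R G *m vz) i 0).
  by rewrite mulmxDl mulmxBl mul1mx -scalemxAl; move: (_ *m vz) => u; rewrite !mxE.
by rewrite Dind_mulmx; case: ifP => _; ring.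
Qed.

(** For [mu = 0] the Jacobian is an orthogonal sum: [H(G)] on [(x, z_G)] and the identity on the
    remaining multipliers. *)
Lemma JFmap0_enorm_sq G w (vx : 'cV[R]_n) (vz : 'cV[R]_m) :
  enorm (JFmap A hess 0 G w *m col_mx vx vz) ^+ 2 =
  enorm (Hmat A hess (xpart w) G *m col_mx vx (subv G vz)) ^+ 2
    + \sum_(i | i \notin G) vz i 0 ^+ 2.
Proof.
rewrite JFmap_mulmx enorm_col_sq Hmat_enorm_sq -addrA; congr (_ + _).
rewrite enorm_sq (bigID (mem G))/=; congr (_ + _); apply: eq_bigr => i iG.
  by rewrite mxE iG mul0r subr0.
by rewrite mxE (negPf iG).
Qed.

Lemma enorm_col_subv_sq (G : {set 'I_m}) (vx : 'cV[R]_n) (vz : 'cV[R]_m) :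
  enorm (col_mx vx vz) ^+ 2 =
  enorm (col_mx vx (subv G vz)) ^+ 2 + \sum_(i | i \notin G) vz i 0 ^+ 2.
Proof.
rewrite !enorm_col_sq enorm_subv_sq -addrA; congr (_ + _).
by rewrite enorm_sq (bigID (mem G)).
Qed.

Lemma cstar_le_half xs : cstar A b hess xs <= 1 / 2.
Proof. by rewrite ler_pM2r ?invr_gt0// bigmin_le_id. Qed.

Lemma cstar_Hmat_le xs (G : {set 'I_m}) v : G \subset Gstar A b xs ->
  2 * cstar A b hess xs * enorm v <= enorm (Hmat A hess xs G *m v).
Proof.
move=> sG; have [k0|k0] := eqVneq (n + #|G|)%N 0%N.
  suff -> : enorm v = 0 by rewrite mulr0 enorm_ge0.
  by rewrite /enorm big1 ?sqrtr0// => -[i ik]; exfalso; rewrite k0 in ik.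
apply: le_trans (smin_mulmx_le _ _); rewrite ler_wpM2r ?enorm_ge0//.
rewrite /cstar mulrC divfK//; apply: le_trans (bigmin_le_cond _ _ sG) _.
by rewrite (negPf k0).
Qed.

Lemma JFmap0_ge xs zs (G : {set 'I_m}) v : G \subset Gstar A b xs -> 0 <= cstar A b hess xs ->
  2 * cstar A b hess xs * enorm v
    <= enorm (JFmap A hess 0 G (col_mx xs zs) *m v).
Proof.
move=> sG c0; have c20 : 0 <= 2 * cstar A b hess xs by rewrite mulr_ge0.
rewrite -(vsubmxK v); set vx := usubmx v; set vz := dsubmx v.
rewrite -ler_sqr ?nnegrE ?(mulr_ge0 c20) ?enorm_ge0//.
rewrite JFmap0_enorm_sq /xpart col_mxKu exprMn (enorm_col_subv_sq G) mulrDr.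
apply: lerD.
  rewrite -exprMn ler_sqr ?nnegrE ?(mulr_ge0 c20) ?enorm_ge0//.
  exact: cstar_Hmat_le.
(* On the identity block the claim reduces to [2 cs <= 1], ensured by the [1] inside the minimum. *)
rewrite ler_piMl ?sumr_ge0// => [i _|]; first exact: sqr_ge0.
by rewrite expr_le1//; have := cstar_le_half xs; lra.
Qed.

(** [Cstar] only controls [H(Gstar)]. A vector on [G] is padded by zeros to [Gstar]; applying
    [H(Gstar)] then only adds the rows of [Gstar] outside [G]. *)
Lemma JFmap0_le xs zs (G : {set 'I_m}) v : G \subset Gstar A b xs ->
  enorm (JFmap A hess 0 G (col_mx xs zs) *m v)
    <= Cstar A b hess xs / 2 * enorm v.
Proof.
move=> sG; rewrite -(vsubmxK v); set vx := usubmx v; set vz := dsubmx v.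
rewrite /Cstar; set Ga := Gstar A b xs in sG *.
set S := specnorm _; set M := Num.max 1 S.
rewrite (_ : 2 * M / 2 = M); last by field.
have M1 : 1 <= M by rewrite le_max lexx.
have M0 : 0 <= M by exact: le_trans M1.
rewrite -ler_sqr ?nnegrE ?mulr_ge0 ?enorm_ge0//.
rewrite JFmap0_enorm_sq /xpart col_mxKu exprMn (enorm_col_subv_sq G) mulrDr.
apply: lerD; last first.
  by rewrite ler_peMl ?sumr_ge0 ?exprn_ege1// => i _; exact: sqr_ge0.
have DD : Dind R Ga *m (Dind R G *m vz) = Dind R G *m vz.
  apply: Dind_id => i iGa; rewrite Dind_mulmx; case: ifP => // iG.
  by rewrite (fintype.subsetP sG _ iG) in iGa.
have -> : enorm (col_mx vx (subv G vz)) = enorm (col_mx vx (subv Ga (Dind R G *m vz))).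
  apply/eqP; rewrite -(@eqrXn2 _ 2) ?enorm_ge0// !enorm_col_sq !enorm_subv_sq.
  apply/eqP; congr (_ + _); rewrite big_mkcond [RHS]big_mkcond.
  apply: eq_bigr => i _; rewrite Dind_mulmx; case: ifPn => iG.
    by rewrite (fintype.subsetP sG _ iG).
  by rewrite expr0n; case: ifP.
set u := col_mx vx (subv Ga (Dind R G *m vz)).
rewrite -exprMn; apply: (@le_trans _ _ (enorm (Hmat A hess xs Ga *m u) ^+ 2)).
  rewrite !Hmat_enorm_sq DD lerD2l [leRHS](big_setID G)/=.
  have -> : Ga :&: G = G by apply/finset.setIidPr.
  by rewrite lerDl sumr_ge0// => i _; exact: sqr_ge0.
rewrite ler_sqr ?nnegrE ?(mulr_ge0 M0) ?enorm_ge0//.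
rewrite (le_trans (enorm_mulmx_le _ _))// ler_wpM2r ?enorm_ge0//.
by rewrite le_max lexx orbT.
Qed.

End LocalAnalysis.

(** * Estimates for a single regularised Newton step *)

Section NewtonStep.
Variables (R : realType) (n m : nat) (A : 'M[R]_(m, n)) (b : 'cV[R]_m).
Variables (grad : 'cV[R]_n -> 'cV[R]_n) (hess : 'cV[R]_n -> 'M[R]_n).
Variables (xs : 'cV[R]_n) (zs : 'cV[R]_m) (L r : R).
Hypothesis dgrad : forall x, differentiable grad x.
Hypothesis gradE : forall x v, 'D_v grad x = hess x *m v.
Hypothesis L0 : 0 < L.
Hypothesis hessL : forall x y : 'cV[R]_n,
  enorm (x - xs) < r -> enorm (y - xs) < r ->
  specnorm (hess x - hess y) <= L * enorm (x - y).
Hypothesis stat : grad xs + A^T *m zs = 0.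

Let ws := col_mx xs zs.
Let cs := cstar A b hess xs.
Let Cs := Cstar A b hess xs.

(** The Hessian is based at the iterate for the Newton step and at the solution for the bounds on
    [F]. The mean value argument gives the constant [L]. *)
Lemma grad_quadratic_le x y : enorm (x - xs) < r -> (y == x) || (y == xs) ->
  enorm (grad x - grad xs - hess y *m (x - xs)) <= L * enorm (x - xs) ^+ 2.
Proof.
move=> xr yxs; apply: (linear_approx_le dgrad gradE) => t /andP[t0 t1].
have e0 := enorm_ge0 (x - xs); have r0 : 0 < r by exact: le_lt_trans xr.
rewrite (le_trans (enorm_mulmx_le _ _))// expr2 mulrA ler_wpM2r//.
have tr : enorm (xs + t *: (x - xs) - xs) < r.
  by rewrite addrC addKr enormZ ger0_norm// (le_lt_trans _ xr)// ler_piMl.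
have yr : enorm (y - xs) < r.
  by case/orP: yxs => /eqP ->//; rewrite subrr enorm0.
rewrite (le_trans (hessL tr yr))// ler_pM2l//.
case/orP: yxs => /eqP ->; last first.
  by rewrite addrC addKr enormZ ger0_norm// ler_piMl.
have -> : xs + t *: (x - xs) - x = (t - 1) *: (x - xs).
  by rewrite scalerBl scale1r opprB [RHS]addrCA addrA.
by rewrite enormZ ler_piMl// ler0_norm ?subr_le0//; lra.
Qed.

Variables (T : {set 'I_m}) (w : 'cV[R]_(n + m)).
Hypothesis TG : T \subset Gstar A b xs.
Hypothesis Tz : forall i, i \notin T -> zs i 0 = 0.
Hypothesis wr : enorm (w - ws) < r.
Hypothesis wL : L * enorm (w - ws) <= cs / 2.
Hypothesis cs0 : 0 < cs.

Let e := enorm (w - ws).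

Let xpart_sub : xpart w - xs = usubmx (w - ws).
Proof. by rewrite /xpart -{2}(vsubmxK w) opp_col_mx add_col_mx col_mxKu. Qed.

Let zpart_sub : zpart w - zs = dsubmx (w - ws).
Proof. by rewrite /zpart -{2}(vsubmxK w) opp_col_mx add_col_mx col_mxKd. Qed.

Let xe : enorm (xpart w - xs) <= e.
Proof. by rewrite xpart_sub enorm_usub. Qed.

(** Because [ws] is a zero of [F(.; T)], only the Taylor remainder of [grad] and the regularisation
    term survive. *)
Lemma Fmap_residual mu w' :
  Fmap A b grad T w - JFmap A hess mu T w' *m (w - ws) =
  col_mx (grad (xpart w) - grad xs - hess (xpart w') *m (xpart w - xs))
    (mu *: (Dind R T *m (zpart w - zs))).
Proof.
have -> : w - ws = col_mx (xpart w - xs) (zpart w - zs).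
  by rewrite xpart_sub zpart_sub vsubmxK.
rewrite JFmap_mulmx /Fmap opp_col_mx add_col_mx; congr col_mx.
  have Dzs : Dind R T *m zs = zs by exact: Dind_id.
  have -> : grad xs = - (A^T *m zs) by apply/eqP; rewrite -addr_eq0 stat.
  rewrite [Dind R T *m (_ - zs)]mulmxBr Dzs [A^T *m (_ - zs)]mulmxBr.
  move: (grad _) (A^T *m zs) (A^T *m _) (_ *m _) => g p q s.
  by apply/matrixP => i j; rewrite !mxE; ring.
apply/matrixP => i j; rewrite ord1 {j} [RHS]mxE Dind_mulmx mulmxBr.
case: (boolP (i \in T)) => iT; last first.
  by rewrite !mxE (negPf iT) (Tz iT); ring.
have /eqP : (A *m xs + b) i 0 == 0.
  by have := fintype.subsetP TG _ iT; rewrite inE.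
move: (A *m xs) (A *m xpart w) => p q; rewrite !mxE iT => pb.
have -> : b i 0 = - p i 0 by apply/eqP; rewrite -addr_eq0 addrC pb.
by ring.
Qed.

Lemma Fmap_residual_le mu w' : 0 <= mu -> (w' == w) || (w' == ws) ->
  enorm (Fmap A b grad T w - JFmap A hess mu T w' *m (w - ws))
    <= L * e ^+ 2 + mu * e.
Proof.
move=> mu0 w'E; rewrite Fmap_residual (le_trans (enorm_col_le _ _))//.
apply: lerD.
  apply: (le_trans (grad_quadratic_le (le_lt_trans xe wr) _)).
    by case/orP: w'E => /eqP ->; rewrite ?eqxx// /xpart col_mxKu eqxx orbT.
  by rewrite ler_pM2l// ler_sqr ?nnegrE ?enorm_ge0.
rewrite enormZ ger0_norm// ler_wpM2l// (le_trans (enorm_Dind_le _ _))//.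
by rewrite zpart_sub enorm_dsub.
Qed.

Lemma JFmap_ge mu v : 0 <= mu <= cs / 2 ->
  cs * enorm v <= enorm (JFmap A hess mu T w *m v).
Proof.
move=> /andP[mu0 mucs].
have lo := @JFmap0_ge R n m A b hess xs zs T v TG (ltW cs0).
suff hi : enorm (JFmap A hess 0 T ws *m v - JFmap A hess mu T w *m v) <= cs * enorm v.
  have := le_trans (enormB _ _) hi; rewrite -/ws -/cs in lo *; lra.
rewrite -(vsubmxK v) !JFmap_mulmx opp_col_mx add_col_mx vsubmxK.
set vx := usubmx v; set vz := dsubmx v.
(* The Jacobian at [ws] expands by [2 cs]. Half of [cs] pays for moving the Hessian from [xs] to
   [xpart w], half for [mu]. *)
rewrite (le_trans (enorm_col_le _ _))// [cs]splitr mulrDl; apply: lerD.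
  rewrite opprD addrACA subrr addr0 -mulmxBl (le_trans (enorm_mulmx_le _ _))//.
  have r0 : 0 < r by exact: le_lt_trans (enorm_ge0 _) wr.
  have -> : xpart ws = xs by rewrite /xpart col_mxKu.
  have := @hessL xs (xpart w); rewrite subrr enorm0 => hL.
  apply: (@le_trans _ _ (L * e * enorm vx)).
    rewrite ler_wpM2r ?enorm_ge0// (le_trans (hL r0 (le_lt_trans xe wr)))//.
    by rewrite ler_pM2l// -enormN opprB xe.
  by apply: ler_pM => //; rewrite ?mulr_ge0 ?enorm_ge0 ?(ltW L0)//; exact: enorm_usub.
rewrite (_ : _ - _ = mu *: (Dind R T *m vz)).
  rewrite enormZ ger0_norm// ler_pM ?enorm_ge0//.
  by rewrite (le_trans (enorm_Dind_le _ _))// enorm_dsub.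
apply/matrixP => i j; rewrite ord1 {j} [RHS]mxE Dind_mulmx.
by move: (A *m vx) => p; rewrite !mxE; case: ifP => _; ring.
Qed.

(** [F] lies within [L e^2 <= cs e / 2] of the linear term at [ws], whose norm is between [2 cs e]
    and [Cs e / 2]. *)
Lemma Fmap_bounds : cs * e <= enorm (Fmap A b grad T w) <= Cs * e.
Proof.
have e0 : 0 <= e by exact: enorm_ge0.
have lo := @JFmap0_ge R n m A b hess xs zs T (w - ws) TG (ltW cs0).
have hi := @JFmap0_le R n m A b hess xs zs T (w - ws) TG.
have := @Fmap_residual_le 0 ws (lexx 0); rewrite eqxx orbT mul0r addr0 => /(_ isT).
rewrite -/ws -/cs -/Cs -/e in lo hi *.
set F := Fmap _ _ _ _ _; set J := _ *m _ in lo hi * => res.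
have q : L * e ^+ 2 <= cs / 2 * e by rewrite expr2 mulrA ler_wpM2r.
have C2 : 2 <= Cs by rewrite /Cs /Cstar ler_peMr// le_max lexx.
have c1 := cstar_le_half A b hess xs; rewrite -/cs in c1.
have Ce : cs / 2 * e <= Cs / 2 * e by rewrite ler_wpM2r//; lra.
have ce : 0 <= cs * e by rewrite mulr_ge0// ltW.
apply/andP; split.
  have := enormB J F; have := enormN (F - J); rewrite opprB; lra.
have := enormD (F - J) J; rewrite subrK; lra.
Qed.

(** Multiplying the new error by the Newton matrix yields minus the residual at [w' = w], and that
    matrix expands by [cs]. *)
Lemma newton_step_le mu : 0 <= mu <= cs / 2 ->
  cs * enorm (w - invmx (JFmap A hess mu T w) *m Fmap A b grad T w - ws)
    <= L * e ^+ 2 + mu * e.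
Proof.
move=> mub; have Jge v := JFmap_ge v mub.
have Ju := unitmx_enorm_ge cs0 Jge.
rewrite (le_trans (Jge _))// addrAC mulmxBr mulKVmx// -enormN opprB.
apply: Fmap_residual_le; last by rewrite eqxx.
by case/andP: mub.
Qed.

End NewtonStep.

(** * Geometric convergence, the iteration count, and the final assembly *)

Lemma cvg_enorm_geometric (R : realType) k (u : nat -> 'cV[R]_k) (l : 'cV[R]_k) (C : R) :
  (forall i, enorm (u i - l) <= C / 2 ^+ i) -> u @ \oo --> l.
Proof.
move=> uC; have C0 : (C / 2 ^+ i @[i --> \oo] --> (0 : R)).
  have -> : (fun i => C / 2 ^+ i) = geometric C 2^-1.
    by apply/funext => i; rewrite /geometric/= exprVn.
  by apply: cvg_geometric; rewrite ger0_norm ?invr_ge0// invf_lt1// ltr1n.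
apply/cvgrPdist_lt => eps eps0.
have /cvgrPdist_lt /(_ _ eps0) := C0; apply: filterS => i.
rewrite sub0r normrN distrC => h.
rewrite (le_lt_trans (mx_norm_le_enorm _))// (le_lt_trans (uC i))//.
exact: le_lt_trans (ler_norm _) h.
Qed.

Lemma ceil_log2_diff_le (R : realType) (X S : R) (k : nat) : 0 < X -> 0 < S ->
  Num.ceil (log2 X - log2 S) <= k%:Z -> X <= 2 ^+ k * S.
Proof.
move=> X0 S0; rewrite ceil_le_int -mulrBl.
have l2 : 0 < ln 2 :> R by rewrite ln_gt0// ltr1n.
rewrite ler_pdivrMr// lerBlDr => h.
have P0 : 0 < 2 ^+ k :> R by rewrite exprn_gt0.
rewrite -ler_ln ?posrE ?mulr_gt0// lnM ?posrE// lnXn//.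
by rewrite -[ln 2 *+ k]mulr_natl.
Qed.

Theorem theorem4p2 (R : realType) (n m : nat)
  (f : 'cV[R]_n -> R) (grad : 'cV[R]_n -> 'cV[R]_n) (hess : 'cV[R]_n -> 'M[R]_n)
  (A : 'M[R]_(m, n)) (b : 'cV[R]_m) (lambda tau : R)
  (xs : 'cV[R]_n) (zs : 'cV[R]_m) (L rho alpha mum1 : R) :
  (* f is twice continuously differentiable with gradient grad and Hessian hess *)
  (forall x, differentiable f x) ->
  (forall x v, 'D_v f x = \sum_i grad x i 0 * v i 0) ->
  (forall x, differentiable grad x) ->
  (forall x v, 'D_v grad x = hess x *m v) ->
  continuous hess ->
  0 < lambda ->
  (* P-stationarity with tau in (0, tau_star) *)
  Pstationary A b grad lambda tau xs zs ->
  0 < tau -> (tau%:E < taustar A b grad lambda xs)%E ->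
  hess xs \in unitmx ->
  row_free (Asub A (Gstar A b xs)) ->
  (forall G : {set 'I_m}, G \subset Gstar A b xs -> Hmat A hess xs G \in unitmx) ->
  0 < L ->
  (exists r, 0 < r /\ forall x y : 'cV[R]_n, enorm (x - xs) < r -> enorm (y - xs) < r ->
      specnorm (hess x - hess y) <= L * enorm (x - y)) ->
  0 < rho -> 0 < alpha < 1 ->
  0 < mum1 <= cstar A b hess xs / 2 ->
  let ws : 'cV[R]_(n + m) := col_mx xs zs in
  let Cs := Cstar A b hess xs in
  let cs := cstar A b hess xs in
  let theta := L + 2 * rho * Cs in
  exists delta : R, 0 < delta /\
    forall w0 : 'cV[R]_(n + m), enorm (w0 - ws) < delta ->
    let w := wseq A b grad hess lambda tau rho alpha w0 mum1 in
    let d := dseq A b grad hess lambda tau rho alpha w0 mum1 in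
    let Fk := Fseq A b grad hess lambda tau rho alpha w0 mum1 in
    (forall k, Jseq A b grad hess lambda tau rho alpha w0 mum1 k \in unitmx) /\
    (* (a) *)
    (d @ \oo --> (0 : 'cV[R]_(n + m))) /\ (w @ \oo --> ws) /\
    (* (b) *)
    (forall k, enorm (w k.+1 - ws) <= theta / cs * enorm (w k - ws) ^+ 2) /\
    (* (c) *)
    (forall k, enorm (Fk k.+1) <= theta * Cs / cs ^+ 3 * enorm (Fk k) ^+ 2) /\
    (forall k, (1 <= k)%N ->
       enorm (Fk k) <= theta * Cs ^+ 3 / cs ^+ 3 * (2 ^+ 2 / 2 ^+ (2 * k))
                        * enorm (w0 - ws) ^+ 2) /\
    (forall eps : R, 0 < eps -> w0 != ws -> forall k : nat, (1 <= k)%N ->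
       (Num.ceil (log2 (2 * Num.sqrt (theta * (Cs / cs) ^+ 3) * enorm (w0 - ws))
                  - log2 (Num.sqrt eps)) <= k%:Z)%R ->
       enorm (Fk k) <= eps).
Proof.
move=> _ _ dg gE _ l0 st t0 tE _ fA _ L0 [r [r0 hL]] rho0 /andP[a0 a1].
move=> /andP[m0 mc] ws Cs cs theta.
have cs0 : 0 < cs by rewrite /cs; lra.
have C2 : 2 <= Cs by rewrite /Cs /Cstar ler_peMr// le_max lexx.
have C0 : 0 < Cs by lra.
have rC : 0 < rho * Cs by rewrite mulr_gt0.
have th0 : 0 < theta by rewrite /theta -mulrA; lra.
have [gz _] := st.
have [eT eT0 hT] := Tset_near l0 t0 st tE fA.
(* In order: control of the index sets, the Lipschitz neighbourhood, [L e <= cs / 2], and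
   [theta e / cs <= 1 / 2], which turns the quadratic bound into halving. *)
pose delta := Num.min (Num.min eT r) (Num.min (cs / (2 * L)) (cs / (2 * theta))).
have step (w : 'cV[R]_(n + m)) (mu : R) :
    enorm (w - ws) < delta -> 0 <= mu <= cs / 2 ->
  [/\ Jk A b grad hess lambda tau rho alpha w mu \in unitmx,
      0 <= muk A b grad lambda tau rho alpha w mu <= cs / 2,
      cs * enorm (w - ws) <= enorm (Fmap A b grad (Tk A b lambda tau w) w)
        <= Cs * enorm (w - ws),
      enorm (w + dk A b grad hess lambda tau rho alpha w mu - ws)
        <= theta / cs * enorm (w - ws) ^+ 2 &
      enorm (w + dk A b grad hess lambda tau rho alpha w mu - ws)
        <= enorm (w - ws) / 2].
  rewrite /delta !lt_min => /andP[/andP[wT wr] /andP[wL wth]] /andP[mu0 muc].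
  rewrite ltr_pdivlMr ?mulr_gt0// in wL; rewrite ltr_pdivlMr ?mulr_gt0// in wth.
  have [TG Tz] := hT w wT.
  have e0 := enorm_ge0 (w - ws).
  have wL' : L * enorm (w - ws) <= cs / 2 by lra.
  have bnd := Fmap_bounds dg gE L0 hL gz TG Tz wr wL' cs0.
  have mub : 0 <= muk A b grad lambda tau rho alpha w mu <= cs / 2.
    rewrite /muk le_min ge_min !mulr_ge0 ?enorm_ge0 ?(ltW a0) ?(ltW rho0)//=.
    by rewrite (le_trans _ muc)// ler_piMl// ltW.
  have st2 := newton_step_le dg gE L0 hL gz TG Tz wr wL' cs0 mub.
  have quad : enorm (w + dk A b grad hess lambda tau rho alpha w mu - ws)
      <= theta / cs * enorm (w - ws) ^+ 2.
    rewrite mulrAC ler_pdivlMr// mulrC; apply: le_trans st2 _.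
    have /andP[_ Fu] := bnd; have /andP[mub0 _] := mub.
    have muF : muk A b grad lambda tau rho alpha w mu
        <= rho * enorm (Fmap A b grad (Tk A b lambda tau w) w).
      by rewrite /muk ge_min lexx orbT.
    (* It remains to see [mu <= rho |F| <= rho Cs e <= 2 rho Cs e]. *)
    rewrite -/ws /theta mulrDl lerD2l expr2 mulrA ler_wpM2r//.
    apply: le_trans muF (le_trans (ler_wpM2l (ltW rho0) Fu) _).
    by rewrite -/ws -/Cs mulrA ler_wpM2r//; lra.
  split=> //.
    exact: (unitmx_enorm_ge cs0 (fun v => JFmap_ge L0 hL TG wr wL' cs0 v mub)).
  apply: le_trans quad _; rewrite expr2 mulrA [leRHS]mulrC ler_wpM2r//.
  by rewrite mulrAC ler_pdivrMr//; lra.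
exists delta; split.
  by rewrite /delta !lt_min eT0 r0 !(divr_gt0 cs0) ?mulr_gt0//.
move=> w0 w0d w d Fk.
pose mus k := (newton A b grad hess lambda tau rho alpha w0 mum1 k).2.
(* The state at [k] stores the previous parameter, so [mus k] is mu with index [k - 1] and
   [mus 0 = mum1]. *)
have inv k : enorm (w k - ws) <= enorm (w0 - ws) / 2 ^+ k /\ 0 <= mus k <= cs / 2.
  elim: k => [|k [ek muk]]; first by rewrite expr0 divr1 lexx (ltW m0).
  have ekd : enorm (w k - ws) < delta.
    apply: le_lt_trans ek (le_lt_trans _ w0d).
    by rewrite ler_pdivrMr ?exprn_gt0// ler_peMr ?enorm_ge0// exprn_ege1// ler1n.
  have [_ mub _ _ half] := step _ _ ekd muk; split=> //.
  apply: le_trans half _; rewrite exprSr invfM mulrA ler_pM2r//.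
have lt_delta k : enorm (w k - ws) < delta.
  apply: le_lt_trans (inv k).1 (le_lt_trans _ w0d).
  by rewrite ler_pdivrMr ?exprn_gt0// ler_peMr ?enorm_ge0// exprn_ege1// ler1n.
have stepk k := step _ _ (lt_delta k) (inv k).2.
have e0 := enorm_ge0 (w0 - ws).
have quad k : enorm (w k.+1 - ws) <= theta / cs * enorm (w k - ws) ^+ 2.
  by have [] := stepk k.
have Fb k : cs * enorm (w k - ws) <= enorm (Fk k) <= Cs * enorm (w k - ws).
  by have [] := stepk k.
have Fquad k : enorm (Fk k.+1) <= theta * Cs / cs * enorm (w k - ws) ^+ 2.
  have /andP[_ /le_trans->//] := Fb k.+1.
  suff -> : theta * Cs / cs * enorm (w k - ws) ^+ 2
      = Cs * (theta / cs * enorm (w k - ws) ^+ 2) by rewrite ler_pM2l.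
  by move: (theta) (cs) (Cs) => p q s; ring.
have tc : 0 <= theta * Cs / cs by rewrite ltW// divr_gt0// mulr_gt0.
have c2 k : (1 <= k)%N -> enorm (Fk k) <= theta * Cs ^+ 3 / cs ^+ 3
    * (2 ^+ 2 / 2 ^+ (2 * k)) * enorm (w0 - ws) ^+ 2.
  (* With the index shifted, [(1 / 2^k)^2 = 2^2 / 2^(2(k+1))]; the stated constant exceeds that of
     [Fquad] by [(Cs / cs)^2 >= 1]. *)
  case: k => // k _; apply: le_trans (Fquad k) _.
  have ek2 : enorm (w k - ws) ^+ 2 <= (enorm (w0 - ws) / 2 ^+ k) ^+ 2.
    rewrite ler_sqr ?nnegrE ?enorm_ge0 ?(inv k).1//.
    exact: le_trans (enorm_ge0 _) (inv k).1.
  apply: le_trans (ler_wpM2l tc ek2) _.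
  have -> : 2 ^+ 2 / 2 ^+ (2 * k.+1) = (2 ^+ k)^-1 ^+ 2 :> R.
    rewrite mulnS exprD exprVn -exprM (mulnC k) invfM mulVKf//.
  rewrite exprMn [_ ^+ 2 * _]mulrC mulrA ler_wpM2r ?sqr_ge0//.
  rewrite ler_wpM2r ?sqr_ge0//.
  have c1 : cs <= 1 by have := cstar_le_half A b hess xs; rewrite -/cs; lra.
  have -> : theta * Cs ^+ 3 / cs ^+ 3 = theta * Cs / cs * (Cs / cs) ^+ 2.
    by field; rewrite gt_eqF.
  rewrite ler_peMr// exprn_ege1// ler_pdivlMr// mul1r; lra.
split; first by move=> k; have [] := stepk k.
split.
  (* The step is the difference of two consecutive errors, each at most [|w0 - ws| / 2^k]. *)
  apply: (@cvg_enorm_geometric _ _ _ _ (enorm (w0 - ws) + enorm (w0 - ws))) => k.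
  rewrite subr0 mulrDl.
  have -> : d k = (w k.+1 - ws) + - (w k - ws).
    rewrite opprB addrA subrK /w /wseq /=; rewrite [X in _ = X - _]addrC addrK.
    by [].
  rewrite (le_trans (enormD _ _))// enormN lerD//; last exact: (inv k).1.
  have [_ _ _ _ half] := stepk k.
  apply: le_trans half _; apply: le_trans (inv k).1.
  by rewrite ler_pdivrMr// ler_peMr ?enorm_ge0// ler1n.
split; first by apply: (@cvg_enorm_geometric _ _ _ _ (enorm (w0 - ws))) => k; exact: (inv k).1.
split; first exact: quad.
split.
  move=> k; apply: le_trans (Fquad k) _.
  have /andP[Fl _] := Fb k.
  have -> : theta * Cs / cs ^+ 3 * enorm (Fk k) ^+ 2
      = theta * Cs / cs * (enorm (Fk k) / cs) ^+ 2 by field; rewrite gt_eqF.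
  rewrite (ler_wpM2l tc)// ler_sqr ?nnegrE ?(divr_ge0 _ (ltW cs0)) ?enorm_ge0//.
  by rewrite ler_pdivlMr// mulrC.
split; first exact: c2.
move=> eps eps0 w0ws k k1 hk; apply: le_trans (c2 k k1) _.
have Q0 : 0 < theta * (Cs / cs) ^+ 3 by rewrite mulr_gt0// exprn_gt0// divr_gt0.
(* Since [w0 != ws], the argument of the logarithm is positive and the logarithm can be inverted. *)
have e00 : 0 < enorm (w0 - ws).
  rewrite lt_def e0 andbT; apply: contra w0ws => /eqP /enorm_eq0 /eqP.
  by rewrite subr_eq0.
have X0 : 0 < 2 * Num.sqrt (theta * (Cs / cs) ^+ 3) * enorm (w0 - ws).
  by rewrite !mulr_gt0// sqrtr_gt0.
have S0 : 0 < Num.sqrt eps by rewrite sqrtr_gt0.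
have hX := ceil_log2_diff_le X0 S0 hk.
set Q := theta * _ in Q0 X0 hX.
(* Squaring [hX] gives the bound [c2] compared with [eps], cleared of its denominator. *)
have h : 2 ^+ 2 * Q * enorm (w0 - ws) ^+ 2 <= 2 ^+ (2 * k) * eps.
  rewrite -{1}(sqr_sqrtr (ltW Q0)) -{1}(sqr_sqrtr (ltW eps0)) (mulnC 2%N) exprM.
  rewrite -!exprMn ler_sqr ?nnegrE ?(ltW X0)//.
have P0 : 0 < 2 ^+ (2 * k) :> R by rewrite exprn_gt0.
have -> : theta * Cs ^+ 3 / cs ^+ 3 = Q by rewrite /Q -mulrA -expr_div_n.
rewrite (_ : _ * _ * _ = 2 ^+ 2 * Q * enorm (w0 - ws) ^+ 2 / 2 ^+ (2 * k)).
  by rewrite ler_pdivrMr// [leRHS]mulrC.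
by move: (Q) (2 ^- (2 * k)) (enorm _ ^+ 2) => q p e; ring.
Qed.
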